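(* Let $m,n$ be integers with $2\le m-1\le n$, and let $H(m,n)=K_m^{\Box n}$ be the Cartesian product of $n$ copies of the complete graph $K_m$. If $\dist(H(m,n))=2$, then $\rho(H(m,n))\in\{\det(H(m,n)),\ \det(H(m,n))+1\}$.
   Context: For a graph $G$: a set $S\subseteq V(G)$ is a determining set if the only automorphism fixing every vertex of $S$ is the identity, and $\det(G)$ is the minimum size of a determining set. A vertex coloring is distinguishing if the only automorphism preserving all color classes is the identity; $\dist(G)$ is the minimum number of colors of a distinguishing coloring. If $\dist(G)=2$, the cost $\rho(G)$ is the minimum size of a color class over all distinguishing 2-colorings of $G$. *)

(* Defs.v *)
From mathcomp Require Import all_boot all_fingroup.

Set Implicit Arguments.
Unset Strict Implicit.
Unset Printing Implicit Defensive.

Record sgraph := SGraph {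
  vertex :> finType;
  adj : rel vertex;
  adj_sym : symmetric adj;
  adj_irrefl : irreflexive adj
}.

Section GraphParameters.

Variable G : sgraph.

Definition graph_aut : {set {perm G}} :=
  [set p : {perm G} | [forall x, forall y, adj (p x) (p y) == adj x y]].

Definition determining (S : {set G}) : bool :=
  [forall p in graph_aut, [forall x in S, p x == x] ==> (p == 1%g)].

Lemma determining_setT : determining setT.
Proof.
apply/forall_inP => p _; apply/implyP => /forall_inP fixp.
by apply/eqP/permP => x; rewrite perm1; apply/eqP/fixp; rewrite in_setT.
Qed.

Definition det : nat := #|[arg min_(S < setT | determining S) #|S|]|.

Lemma det_leq (S : {set G}) : determining S -> det <= #|S|.
Proof.
by rewrite /det; case: arg_minnP => [|T _ minT /minT //]; apply: determining_setT.
Qed.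

Lemma det_witness : exists2 S : {set G}, determining S & #|S| = det.
Proof.
rewrite /det; case: arg_minnP => [|T detT _]; first exact: determining_setT.
by exists T.
Qed.

Definition color_class k (c : {ffun G -> 'I_k}) (i : 'I_k) : {set G} :=
  [set x | c x == i].

Definition distinguishing k (c : {ffun G -> 'I_k}) : bool :=
  [forall p in graph_aut,
     [forall i, p @: color_class c i == color_class c i] ==> (p == 1%g)].

Definition distinguishable (k : nat) : bool :=
  [exists c : {ffun G -> 'I_k}, distinguishing c].

Lemma preserves_classesP k (c : {ffun G -> 'I_k}) (p : {perm G}) :
  reflect (forall x, c (p x) = c x)
          [forall i, p @: color_class c i == color_class c i].
Proof.
apply: (iffP forallP) => [pc x | pc i].
  have: p x \in p @: color_class c (c x) by rewrite imset_f // inE.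
  by rewrite (eqP (pc _)) inE => /eqP.
rewrite eqEcard card_imset ?leqnn ?andbT; last exact: perm_inj.
by apply/subsetP => _ /imsetP[x + ->]; rewrite !inE pc.
Qed.

Lemma distinguishable_card : distinguishable #|G|.
Proof.
apply/existsP; exists [ffun x => enum_rank x].
apply/forall_inP => p _; apply/implyP => /preserves_classesP pc.
apply/eqP/permP => x; rewrite perm1; apply: enum_rank_inj.
by have := pc x; rewrite !ffunE.
Qed.

Definition dist : nat := ex_minn (ex_intro distinguishable _ distinguishable_card).

(* The cost is only meaningful when a distinguishing 2-coloring exists; it is
   then attained and the neutral value #|G| is irrelevant, see [cost_witness]. *)
Definition cost : nat :=
  \big[minn/#|G|]_(c : {ffun G -> 'I_2} | distinguishing c)
    \big[minn/#|G|]_(i : 'I_2) #|color_class c i|.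

Lemma cost_leq (c : {ffun G -> 'I_2}) (i : 'I_2) :
  distinguishing c -> cost <= #|color_class c i|.
Proof.
have bigmin_leq (I : finType) (P : pred I) (F : I -> nat) (N : nat) (j : I) :
    P j -> \big[minn/N]_(j | P j) F j <= F j.
  move=> Pj; have := mem_index_enum j; elim: (index_enum I) => // l s IHs.
  rewrite inE big_cons => /predU1P[<-|/IHs le_s]; first by rewrite Pj geq_minl.
  by case: ifP => // _; rewrite geq_min le_s orbT.
move=> dc; apply: leq_trans (bigmin_leq _ _ _ _ _ dc) _.
exact: (bigmin_leq _ xpredT (fun i => #|color_class c i|)).
Qed.

Lemma cost_witness : distinguishable 2 ->
  exists c : {ffun G -> 'I_2}, exists i : 'I_2,
    distinguishing c /\ #|color_class c i| = cost.
Proof.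
move=> /existsP[c0 dc0].
have bigmin_att (I : finType) (P : pred I) (F : I -> nat) (N : nat) :
    \big[minn/N]_(j | P j) F j = N \/
    exists2 j, P j & F j = \big[minn/N]_(j | P j) F j.
  rewrite -big_filter.
  have: {subset [seq j <- index_enum I | P j] <= P}.
    by move=> j; rewrite mem_filter => /andP[].
  elim: [seq j <- _ | _] => [|j s IHs] sP; first by left; rewrite big_nil.
  rewrite big_cons /minn; case: ifP => _.
    by right; exists j => //; apply: sP; apply: mem_head.
  by apply: IHs => l ls; apply: sP; rewrite inE ls orbT.
have [costN | [c dc cc]] := bigmin_att _ (fun c => distinguishing c)
    (fun c => \big[minn/#|G|]_(i : 'I_2) #|color_class c i|) #|G|.
  exists c0, ord0; split=> //; apply/eqP; rewrite eqn_leq cost_leq // andbT.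
  by rewrite [cost]costN max_card.
have [iN | [i _ ii]] := bigmin_att _ xpredT (fun i => #|color_class c i|) #|G|.
  exists c, ord0; split=> //; apply/eqP; rewrite eqn_leq cost_leq // andbT.
  by rewrite /cost -cc iN max_card.
by exists c, i; split=> //; rewrite ii cc.
Qed.

End GraphParameters.

Section CompleteGraph.

Variable m : nat.

Definition complete_adj : rel 'I_m := fun x y => x != y.

Lemma complete_adj_sym : symmetric complete_adj.
Proof. by move=> x y; rewrite /complete_adj eq_sym. Qed.

Lemma complete_adj_irrefl : irreflexive complete_adj.
Proof. by move=> x; rewrite /complete_adj eqxx. Qed.

Definition complete_graph : sgraph :=
  SGraph complete_adj_sym complete_adj_irrefl.

End CompleteGraph.

Section CartesianPower.

Variables (G : sgraph) (n : nat).

Definition cart_adj : rel {ffun 'I_n -> G} := fun x y =>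
  [exists i, adj (x i) (y i) && [forall j, (j != i) ==> (x j == y j)]].

Lemma cart_adj_sym : symmetric cart_adj.
Proof.
move=> x y; apply: eq_existsb => i; rewrite adj_sym; congr (_ && _).
by apply: eq_forallb => j; rewrite (eq_sym (x j)).
Qed.

Lemma cart_adj_irrefl : irreflexive cart_adj.
Proof. by move=> x; apply/existsP => -[i]; rewrite adj_irrefl. Qed.

Definition cart_power : sgraph := SGraph cart_adj_sym cart_adj_irrefl.

End CartesianPower.

Definition hamming (m n : nat) : sgraph := cart_power (complete_graph m) n.

(* Main.v *)
Require Import Defs.
From mathcomp Require Import all_boot all_fingroup.
From mathcomp Require Import zify.

Set Implicit Arguments.
Unset Strict Implicit.
Unset Printing Implicit Defensive.

(** A set of k vertices of H(m,n) is a k x n matrix, and its columns are n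
    partitions of the k rows. As Aut(H(m,n)) is the wreath product of S_m by S_n,
    a set is determining iff the columns are distinct partitions into m-1 or m
    blocks, and it is a color class of a distinguishing 2-coloring iff moreover
    no nontrivial permutation of the rows permutes the columns. Every color
    class of a distinguishing coloring is determining, so det <= cost, and it
    remains to find a rigid family of n partitions on at most det + 1 points.

    If n > m, take k = min(det + 1, n) points on a line. The k-1 partitions into
    m-1 intervals whose cuts form a cyclic interval of positions determine the
    order up to reversal, and k <= n leaves room for one partition into m blocks
    that is not invariant under reversal. The remaining n - k members are
    partitions into m blocks obtained by adding a row to a minimum determining
    set. If n is m-1 or m, then k = m+1 points suffice: merging two consecutive
    points of a path gives n-1 partitions into m blocks, and a triple breaks the
    reversal. This needs n >= 3; the case left, K_3 x K_3, has no distinguishing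
    2-coloring. *)

(** * Automorphisms and determining sets of Hamming graphs *)

(** Points are added one at a time: a transposition corrects the value at the new point, and
    equality of the kernels ensures that it leaves the earlier values alone. *)
Lemma same_kernel_perm (T U : finType) (f h : T -> U) :
  (forall x y, (f x == f y) = (h x == h y)) ->
  exists g : {perm U}, forall x, g (f x) = h x.
Proof.
move=> fh; suff [g gP] : exists g : {perm U}, {in enum T, forall x, g (f x) = h x}.
  by exists g => x; apply: gP; rewrite mem_enum.
elim: (enum T) => [|t s [g gP]]; first by exists 1%g.
have [gt | gt] := eqVneq (g (f t)) (h t).
  by exists g => x; rewrite inE => /predU1P[->|/gP].
exists (g * tperm (g (f t)) (h t))%g => x; rewrite inE permM => /predU1P[->|xs].
  by rewrite tpermL.
rewrite (gP _ xs) tpermD //.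
  apply: contraNneq gt => e; rewrite e -fh -(inj_eq (@perm_inj _ g)).
  by rewrite (gP _ xs) e.
by apply: contraNneq gt => e; rewrite e -(gP _ xs) (inj_eq perm_inj) fh e.
Qed.

Notation word m n := {ffun 'I_n -> 'I_m}.

Definition agree_off m n (i : 'I_n) (x y : word m n) : bool :=
  [forall j, (j != i) ==> (x j == y j)].

Definition update m n (x : word m n) (i : 'I_n) (a : 'I_m) : word m n :=
  [ffun j => if j == i then a else x j].

Lemma agree_offP m n (i : 'I_n) (x y : word m n) :
  reflect (forall j, j != i -> x j = y j) (agree_off i x y).
Proof. by apply: (iffP forall_inP) => h j /h => [/eqP|->]. Qed.

Lemma agree_off_sym m n (i : 'I_n) (x y : word m n) :
  agree_off i x y -> agree_off i y x.
Proof. by move=> /agree_offP h; apply/agree_offP => j /h. Qed.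

Lemma agree_off_trans m n (i : 'I_n) (x y z : word m n) :
  agree_off i x y -> agree_off i y z -> agree_off i x z.
Proof.
by move=> /agree_offP h /agree_offP l; apply/agree_offP => j ji; rewrite h ?l.
Qed.

Lemma agree_off_update m n (i : 'I_n) (x : word m n) a :
  agree_off i x (update x i a).
Proof. by apply/agree_offP => j /negPf ji; rewrite ffunE ji. Qed.

Lemma agree_off_eq m n (i : 'I_n) (x y : word m n) :
  agree_off i x y -> x i = y i -> x = y.
Proof.
by move=> /agree_offP h e; apply/ffunP => j; have [->|/h] := eqVneq j i.
Qed.

Lemma hamming_adjP m n (x y : word m n) :
  reflect (exists i, x i != y i /\ agree_off i x y) (@adj (hamming m n) x y).
Proof.
apply: (iffP existsP) => -[i].
  by move=> /andP[xy h]; exists i.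
by move=> [xy h]; exists i; apply/andP.
Qed.

Lemma agree_off_adj m n (i : 'I_n) (x y : word m n) :
  agree_off i x y -> x != y -> @adj (hamming m n) x y.
Proof.
move=> h xy; apply/hamming_adjP; exists i; split=> //.
by apply: contraNneq xy => e; rewrite (agree_off_eq h e).
Qed.

Lemma not_adj2 m n (i j : 'I_n) (x y : word m n) :
  i != j -> x i != y i -> x j != y j -> ~~ @adj (hamming m n) x y.
Proof.
move=> ij xi xj; apply/hamming_adjP => -[l [_ /agree_offP h]].
have /eqP li : i == l by apply: contraNT xi => /h ->.
by move: xj; rewrite h ?eqxx // -li eq_sym.
Qed.

(** Connectivity of the graph as an induction principle: the coordinates where [x] differs from [y]
    are corrected one after the other. *)
Lemma word_update_ind m n (Q : word m n -> Prop) (x y : word m n) :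
  Q x -> (forall z j, Q z -> x j != y j -> Q (update z j (y j))) -> Q y.
Proof.
move=> Qx Qu.
have Qs (s : seq 'I_n) : Q [ffun j => if j \in s then y j else x j].
  elim: s => [|j s IH].
    by have -> : [ffun j => if j \in [::] then y j else x j] = x
      by apply/ffunP => j; rewrite ffunE.
  have [e|ne] := eqVneq (x j) (y j); last first.
    have := Qu _ _ IH ne; congr Q; apply/ffunP => l; rewrite !ffunE inE.
    by case: eqP => [->|].
  move: IH; congr Q; apply/ffunP => l; rewrite !ffunE inE.
  by case: eqP => [->|//] /=; rewrite e if_same.
by have := Qs (enum 'I_n); congr Q; apply/ffunP => j; rewrite ffunE mem_enum.
Qed.

Lemma exists_other m (a : 'I_m) : 1 < m -> exists b : 'I_m, b != a.
Proof.
move=> m1; have /card_gt0P[b] : 0 < #|[set~ a]| by rewrite cardsC1 card_ord; lia.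
by rewrite !inE; exists b.
Qed.

Lemma aut_adj m n (p : {perm word m n}) :
  p \in @graph_aut (hamming m n) ->
  forall x y, @adj (hamming m n) (p x) (p y) = @adj (hamming m n) x y.
Proof. by rewrite inE => /forallP h x y; have /forallP/(_ y)/eqP := h x. Qed.

(** A line is a clique, whereas two neighbours of a vertex in distinct directions are not adjacent.
    So the image of a single neighbour [y0] decides the direction for the whole line. *)
Lemma line_image m n (p : {perm word m n}) (x : word m n) i :
  1 < m -> p \in @graph_aut (hamming m n) ->
  exists d, forall y, agree_off i x y -> agree_off d (p x) (p y).
Proof.
move=> m1 pa; have [b bx] := exists_other (x i) m1.
pose y0 := update x i b; have xy0 := agree_off_update i x b.
have y0i : y0 i = b by rewrite ffunE eqxx.
have nxy0 : x != y0 by apply: contraNneq bx => e; rewrite -y0i -e.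
have := agree_off_adj xy0 nxy0; rewrite -(aut_adj pa) => /hamming_adjP[d [pd hd]].
exists d => y xy; have [<-|nxy] := eqVneq x y; first by apply/agree_offP.
have [->|nyy0] := eqVneq y y0; first by [].
have := agree_off_adj xy nxy; rewrite -(aut_adj pa) => /hamming_adjP[e [pe he]].
have [<- //|ed] := eqVneq e d.
have := agree_off_adj (agree_off_trans (agree_off_sym xy) xy0) nyy0.
rewrite -(aut_adj pa) (negPf (not_adj2 ed _ _)) //.
  by rewrite eq_sym -(agree_offP _ _ _ hd).
by rewrite -(agree_offP _ _ _ he) // eq_sym.
Qed.

(* The four corners of a square in directions i, j are sent to the corners of
   a square, whose opposite sides are parallel. *)
Lemma line_image_update m n (p : {perm word m n}) (x : word m n) i d j a :
  p \in @graph_aut (hamming m n) ->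
  (forall y, agree_off i x y -> agree_off d (p x) (p y)) ->
  forall y, agree_off i (update x j a) y ->
    agree_off d (p (update x j a)) (p y).
Proof.
move=> pa dx y; set x' := update x j a => x'y.
have xx' : agree_off j x x' := agree_off_update j x a.
have [ji|ji] := eqVneq j i.
  rewrite ji in xx'.
  exact: agree_off_trans (agree_off_sym (dx _ xx')) (dx _ (agree_off_trans xx' x'y)).
have [e|nxx'] := eqVneq x x'; first by rewrite -e in x'y *; apply: dx.
have [->|nx'y] := eqVneq x' y; first by apply/agree_offP.
have x'i : x' i = x i by rewrite ffunE eq_sym (negPf ji).
have yi : y i != x i.
  by rewrite -x'i; apply: contraNneq nx'y => e; rewrite (agree_off_eq x'y (esym e)).
pose w := update x i (y i).
have xw : agree_off i x w := agree_off_update i x (y i).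
have wi : w i = y i by rewrite ffunE eqxx.
have wj : w j = x j by rewrite ffunE (negPf ji).
have wy : agree_off j w y.
  apply/agree_offP => l lj; rewrite ffunE; case: eqVneq => [->//|li].
  by rewrite -(agree_offP _ _ _ x'y) // ffunE (negPf lj).
have x'j : x' j != x j.
  by apply: contraNneq nxx' => e; rewrite (agree_off_eq xx' (esym e)).
have yj : y j = x' j by rewrite (agree_offP _ _ _ x'y).
have nwy : w != y by apply: contraNneq x'j => e; rewrite -yj -e wj.
have := agree_off_adj xx' nxx'; rewrite -(aut_adj pa) => /hamming_adjP[f [pf hf]].
have := agree_off_adj wy nwy; rewrite -(aut_adj pa) => /hamming_adjP[h [ph hh]].
have := agree_off_adj x'y nx'y; rewrite -(aut_adj pa) => /hamming_adjP[e [pe he]].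
have [<- //|ed] := eqVneq e d.
have hd := dx _ xw.
have fd : f != d.
  apply/negP => /eqP fd; rewrite fd in hf.
  have x'w : agree_off d (p x') (p w) := agree_off_trans (agree_off_sym hf) hd.
  have nx'w : p x' != p w.
    by rewrite (inj_eq perm_inj); apply: contraNneq yi => q; rewrite -wi -q x'i.
  have := agree_off_adj x'w nx'w; rewrite (aut_adj pa) (negPf (not_adj2 ji _ _)) //.
    by rewrite wj.
  by rewrite wi x'i eq_sym.
have px'd : p x' d = p x d by rewrite -(agree_offP _ _ _ hf) // eq_sym.
have pyd : p y d = p x d by rewrite -(agree_offP _ _ _ he) // eq_sym.
have pwd : p w d != p y d.
  rewrite pyd; apply: contraNneq yi => q.
  by have /perm_inj q' := agree_off_eq hd (esym q); rewrite -wi -q'.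
have hd' : h = d.
  by apply/eqP; apply: contraNT pwd => nhd; rewrite (agree_offP _ _ _ hh) // eq_sym.
rewrite hd' in hh.
have /perm_inj q := agree_off_eq (agree_off_trans hd hh) (esym pyd).
by rewrite -q eqxx in yi.
Qed.

(** The direction of the image of a line depends only on the direction of the line, since moving the
    base point preserves it. This yields [r], injective because neighbours in distinct directions
    are not adjacent. *)
Lemma hamming_aut_coord m n (p : {perm word m n}) :
  1 < m -> p \in @graph_aut (hamming m n) ->
  exists r : {perm 'I_n},
    forall x y i, (p x (r i) == p y (r i)) = (x i == y i).
Proof.
move=> m1 pa; pose o := Ordinal (ltnW m1); pose x0 : word m n := [ffun=> o].
have /fin_all_exists[r rP] i : exists d, forall x y : word m n,
    agree_off i x y -> agree_off d (p x) (p y).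
  have [d dP] := line_image x0 i m1 pa; exists d => x.
  apply: (word_update_ind (Q := fun x => forall y, agree_off i x y ->
                             agree_off d (p x) (p y)) dP) => z j dz _.
  exact: line_image_update.
have r_inj : injective r.
  move=> i j rij; apply/eqP; apply: contraT => nij.
  have [b bo] := exists_other o m1.
  pose y := update x0 i b; pose z := update x0 j b.
  have yi : y i != z i by rewrite !ffunE eqxx (negPf nij).
  have yj : y j != z j by rewrite !ffunE eqxx [j == i]eq_sym (negPf nij) eq_sym.
  have := not_adj2 nij yi yj; rewrite -(aut_adj pa).
  have xy := rP i _ _ (agree_off_update i x0 b).
  have xz := rP j _ _ (agree_off_update j x0 b).
  rewrite -rij in xz.
  rewrite (agree_off_adj (agree_off_trans (agree_off_sym xy) xz)) //.
  by rewrite (inj_eq perm_inj); apply: contraNneq yi => e; rewrite /y e.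
exists (perm r_inj) => x y i; rewrite permE.
have eqr (u v : word m n) : u i = v i -> p u (r i) = p v (r i).
  move=> uv; apply: (word_update_ind (Q := fun z => p u (r i) = p z (r i)) (x := u)) => // z j.
  move=> -> uvj; apply: (agree_offP _ _ _ (rP j _ _ (agree_off_update _ _ _))).
  by rewrite (inj_eq r_inj); apply: contraNneq uvj => <-; rewrite uv.
apply/eqP/eqP => [pxy|]; last exact: eqr.
(* [w] lies on the line through [x] in direction [i], and its image agrees with that of [x] in
   coordinate [r i] as well as off it, so [w = x]. *)
have := agree_off_update i x (y i); set w := update _ _ _ => xw.
have wi : w i = y i by rewrite ffunE eqxx.
rewrite -(eqr _ _ wi) in pxy.
by rewrite -wi; have /perm_inj <- := agree_off_eq (rP _ _ _ xw) pxy.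
Qed.

Lemma wreath_aut m n (r : {perm 'I_n}) (g : 'I_n -> {perm 'I_m}) :
  exists2 p : {perm word m n}, p \in @graph_aut (hamming m n) &
    forall x i, p x i = g i (x (r i)).
Proof.
pose f (x : word m n) : word m n := [ffun i => g i (x (r i))].
have f_inj : injective f.
  move=> x y /ffunP fxy; apply/ffunP => i; apply: (@perm_inj _ (g (r^-1 i)%g)).
  by have := fxy (r^-1 i)%g; rewrite !ffunE permKV.
exists (perm f_inj) => [|x i]; last by rewrite permE ffunE.
rewrite inE; apply/forallP => x; apply/forallP => y; apply/eqP.
rewrite !permE; apply/hamming_adjP/hamming_adjP => -[i [xy /agree_offP h]].
  exists (r i); split; first by move: xy; rewrite !ffunE (inj_eq perm_inj).
  apply/agree_offP => j ji; apply: (@perm_inj _ (g (r^-1 j)%g)).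
  have := h (r^-1 j)%g; rewrite !ffunE permKV; apply.
  by apply: contraNneq ji => <-; rewrite permKV.
exists (r^-1 i)%g; split; first by rewrite !ffunE (inj_eq perm_inj) permKV.
apply/agree_offP => j ji; rewrite !ffunE h //.
by apply: contraNneq ji => <-; rewrite permK.
Qed.

(** Two symbols absent from column [i] could be exchanged there without moving any vertex of [S]. *)
Lemma determining_symbols m n (S : {set word m n}) i :
  @determining (hamming m n) S -> m - 1 <= #|[set x i | x : word m n in S]|.
Proof.
move=> detS; rewrite leqNgt; apply/negP => lt.
have : 1 < #|~: [set x i | x : word m n in S]|.
  by have := cardsC [set x i | x : word m n in S]; rewrite card_ord; lia.
case/card_gt1P=> a [b [aS bS ab]].
have [p pa pE] := wreath_aut 1 (fun j => if j == i then tperm a b else 1%g).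
have /forall_inP/(_ _ pa)/implyP p1 := detS.
have /eqP p1' : p == 1%g.
  apply: p1; apply/forall_inP => x xS; apply/eqP/ffunP => j.
  rewrite pE perm1; case: eqVneq => [->|]; last by rewrite perm1.
  rewrite !inE in aS bS.
  by rewrite tpermD //; [apply: contraNneq aS|apply: contraNneq bS] => ->;
    apply: imset_f.
have := pE [ffun=> a] i; rewrite p1' !perm1 !ffunE eqxx tpermL => /eqP.
by rewrite (negPf ab).
Qed.

(** Two columns inducing the same partition of [S] could be exchanged, recoding the symbols by [g]
    and its inverse, with [S] fixed pointwise. *)
Lemma determining_columns m n (S : {set word m n}) i j :
  1 < m -> @determining (hamming m n) S ->
  (forall x y : word m n, x \in S -> y \in S -> (x i == y i) = (x j == y j)) ->
  i = j.
Proof.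
move=> m1 detS same; apply/eqP; apply: contraT => ij.
have [|g gP] := @same_kernel_perm 'I_#|S| _ (fun t => (enum_val t : word m n) i)
  (fun t => (enum_val t : word m n) j).
  by move=> t u; apply: same; apply: enum_valP.
pose h l := if l == j then g else if l == i then g^-1%g else 1%g.
have [p pa pE] := wreath_aut (tperm i j) h.
have /forall_inP/(_ _ pa)/implyP p1 := detS.
have /eqP p1' : p == 1%g.
  apply: p1; apply/forall_inP => x xS; apply/eqP/ffunP => l.
  have gx : g (x i) = x j.
    by have := gP (enum_rank_in xS x); rewrite enum_rankK_in.
  rewrite pE /h; case: eqVneq => [->|lj]; first by rewrite tpermR.
  case: eqVneq => [->|li]; first by rewrite tpermL -gx permK.
  by rewrite perm1 tpermD // eq_sym.
pose a := Ordinal (ltnW m1); have [b ba] := exists_other (g a) m1.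
have := pE [ffun l => if l == i then a else b] j.
rewrite p1' perm1 !ffunE /h eqxx tpermR eqxx eq_sym (negPf ij) => /eqP.
by rewrite (negPf ba).
Qed.

(** * Rigid families of partitions *)

(** Storing a partition as a set of pairs forgets the symbols: columns that differ by a relabelling
    become equal. *)
Definition kernel (T : finType) (U : eqType) (c : T -> U) : {set T * T} :=
  [set q | c q.1 == c q.2].

Definition nblocks (T : finType) (K : {set T * T}) : nat :=
  #|[set [set y | (x, y) \in K] | x : T]|.

Definition pullback (T : finType) (s : {perm T}) (K : {set T * T}) :
  {set T * T} := [set q | (s q.1, s q.2) \in K].

(* [K] is a partition into [b] blocks which can be a column over 'I_m. *)
Definition is_partition m (T : finType) (b : nat) (K : {set T * T}) : Prop :=
  (exists c : T -> 'I_m, K = kernel c) /\ nblocks K = b.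

(** Stability of [F] suffices as the premise: [pullback s] is injective and [F] finite, so [F] is
    then permuted. *)
Definition rigid (T : finType) (F : {set {set T * T}}) : Prop :=
  forall s : {perm T}, (forall K, K \in F -> pullback s K \in F) -> s = 1%g.

Lemma kernelP (T : finType) (U V : eqType) (c : T -> U) (d : T -> V) :
  kernel c = kernel d <-> (forall x y, (c x == c y) = (d x == d y)).
Proof.
split=> [/setP e x y|e]; first by have := e (x, y); rewrite !inE.
by apply/setP => -[x y]; rewrite !inE e.
Qed.

Lemma pullback_kernel (T : finType) (U : eqType) (s : {perm T}) (c : T -> U) :
  pullback s (kernel c) = kernel (c \o s).
Proof. by apply/setP => -[x y]; rewrite !inE. Qed.

Lemma pullback_inj (T : finType) (s : {perm T}) : injective (pullback s).
Proof.
move=> K L /setP e; apply/setP => -[x y].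
by have := e (s^-1 x, s^-1 y)%g; rewrite !inE /= !permKV.
Qed.

Lemma nblocks_kernel (T U : finType) (c : T -> U) :
  nblocks (kernel c) = #|[set c x | x : T]|.
Proof.
have -> : nblocks (kernel c) = #|[set c @^-1: [set v] | v in c @: T]|.
  rewrite /nblocks -imset_comp; congr #|pred_of_set _|.
  apply: eq_imset => x; apply/setP => y.
  by rewrite !inE eq_sym.
rewrite card_in_imset // => _ w /imsetP[x _ ->] _ /setP/(_ x).
by rewrite !inE eqxx => /esym/eqP.
Qed.

Lemma is_partition_pullback m (T : finType) b (s : {perm T}) (K : {set T * T}) :
  is_partition m b K -> is_partition m b (pullback s K).
Proof.
move=> [[c ->] <-]; rewrite pullback_kernel; split; first by exists (c \o s).
rewrite !nblocks_kernel; congr #|pred_of_set _|; apply/setP => v.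
apply/imsetP/imsetP => -[x _ ->]; first by exists (s x).
by exists (s^-1 x)%g => //=; rewrite permKV.
Qed.

Lemma is_partition_label m k (f : nat -> nat) b : b <= m ->
  (forall x, x < k -> f x < b) ->
  (forall v, v < b -> exists2 x, x < k & f x = v) ->
  is_partition m b (kernel (fun x : 'I_k => f x)).
Proof.
move=> bm fb fs.
pose c (x : 'I_k) := Ordinal (fb x (ltn_ord x)).
have ker_c : kernel (fun x : 'I_k => f x) = kernel c by apply/kernelP.
split.
  by exists (fun x => widen_ord bm (c x)); rewrite ker_c; apply/kernelP.
rewrite ker_c nblocks_kernel -[RHS]card_ord -cardsT; congr #|pred_of_set _|.
apply/setP => v; rewrite inE; apply/imsetP.
by have [x xk fx] := fs v (ltn_ord v); exists (Ordinal xk) => //; apply: val_inj.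
Qed.

(** The members of [F] serve as columns and the [k] rows form the color class. Equal rows could be
    swapped without changing any member, so the rows are distinct. An automorphism preserving the
    class permutes the rows by [s] and the columns by [r]; rigidity gives [s = 1], and distinctness
    of the columns then gives [r = 1]. *)
Lemma cost_rigid m n k (F : {set {set 'I_k * 'I_k}}) :
  1 < m -> #|F| = n ->
  (forall K, K \in F -> exists2 b, m - 1 <= b & is_partition m b K) ->
  rigid F -> cost (hamming m n) <= k.
Proof.
move=> m1 Fn Fpart Frig.
pose K i := enum_val (cast_ord (esym Fn) i) : {set 'I_k * 'I_k}.
have KF i : K i \in F by apply: enum_valP.
have K_inj : injective K by move=> i j /enum_val_inj/cast_ord_inj.
have /fin_all_exists[c cP] (i : 'I_n) : exists c : 'I_k -> 'I_m,
    K i = kernel c /\ m - 1 <= #|[set c x | x : 'I_k]|.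
  have [b mb [[c ec] Kb]] := Fpart _ (KF i); exists c; split=> //.
  by rewrite -nblocks_kernel -ec Kb.
pose row (x : 'I_k) : word m n := [ffun i => c i x].
have row_inj : injective row.
  move=> x y /ffunP rxy.
  have cxy i : c i x = c i y by have := rxy i; rewrite !ffunE.
  suff t1 : tperm x y = 1%g by rewrite -(tpermL x y) t1 perm1.
  apply: Frig => L LF.
  have -> // : pullback (tperm x y) L = L.
  have <- : K (cast_ord Fn (enum_rank_in LF L)) = L.
    by rewrite /K cast_ordK enum_rankK_in.
  rewrite (cP _).1 pullback_kernel; apply/kernelP => u v /=.
  by do 2![case: tpermP => [->|->|_ _]]; rewrite ?cxy.
pose S : {set hamming m n} := [set row x | x : 'I_k].
have S_card : #|S| = k by rewrite card_imset // card_ord.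
pose col : {ffun hamming m n -> 'I_2} := [ffun x => inord (x \in S)].
have colS : color_class col ord_max = S.
  apply/setP => x; rewrite inE ffunE -val_eqE /= inordK; last by case: (x \in S).
  by case: (x \in S).
rewrite -[X in _ <= X]S_card -colS; apply: cost_leq.
apply/forall_inP => p pa; apply/implyP => /forallP/(_ ord_max)/eqP.
rewrite colS => pS.
have /fin_all_exists[s sP] (x : 'I_k) : exists y, p (row x) = row y.
  have : p (row x) \in S by rewrite -pS; apply: imset_f; apply: imset_f.
  by case/imsetP => y _ ->; exists y.
have s_inj : injective s.
  by move=> x y e; apply: row_inj; apply: (@perm_inj _ p); rewrite !sP e.
have [r rP] := hamming_aut_coord m1 pa.
have crs i x y : (c (r i) (s x) == c (r i) (s y)) = (c i x == c i y).
  by have := rP (row x) (row y) i; rewrite !sP !ffunE.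
have s1 : perm s_inj = 1%g.
  apply: Frig => L LF.
  have [i <-] : exists i, K (r i) = L.
    exists (r^-1 (cast_ord Fn (enum_rank_in LF L)))%g.
    by rewrite permKV /K cast_ordK enum_rankK_in.
  suff -> : pullback (perm s_inj) (K (r i)) = K i by [].
  rewrite !(cP _).1 pullback_kernel; apply/kernelP => x y /=.
  by rewrite !permE crs.
have sE x : s x = x by rewrite -(permE s_inj) s1 perm1.
have rE i : r i = i.
  apply: K_inj; rewrite !(cP _).1; apply/kernelP => x y.
  by have := crs i x y; rewrite !sE.
(* An injection of the symbols fixing all but one of them is the identity. *)
have fixv i (z : word m n) : p z i = z i.
  have imi := (cP i).2.
  have fix_im v : v \in [set c i x | x : 'I_k] -> forall z : word m n, z i = v -> p z i = v.
    move=> /imsetP[x _ ->] y yi; apply/eqP; rewrite -yi.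
    have := rP y (row x) i; rewrite rE sP sE ffunE yi eqxx => /eqP ->.
    by rewrite eqxx.
  apply/eqP; apply: contraT => ne.
  have z_im : z i \notin [set c i x | x : 'I_k].
    by apply: contra ne => /fix_im ->.
  have pz_im : p z i \notin [set c i x | x : 'I_k].
    apply: contra ne => h; have := rP (update z i (p z i)) z i.
    by rewrite rE (fix_im _ h) ffunE eqxx // => <-.
  have : 1 < #|~: [set c i x | x : 'I_k]|.
    by apply/card_gt1P; exists (p z i), (z i); rewrite !inE.
  by have := cardsC [set c i x | x : 'I_k]; rewrite card_ord; lia.
by apply/eqP/permP => z; rewrite perm1; apply/ffunP => i.
Qed.

(** * Path families *)

(** Injectivity forbids turning back, so the first step fixes the direction of all the others; the
    bound [L] then forces the starting value. *)
Lemma path_embedding (v : nat -> nat) L : 1 < L ->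
  (forall x, x < L -> v x < L) ->
  (forall x y, x < L -> y < L -> v x = v y -> x = y) ->
  (forall x, x.+1 < L -> v x.+1 = (v x).+1 \/ v x = (v x.+1).+1) ->
  (forall x, x < L -> v x = x) \/ (forall x, x < L -> v x = L.-1 - x).
Proof.
move=> L1 vL v_inj v_adj.
have [up|down] := v_adj 0 L1.
  left; have vS x : x.+1 < L -> v x.+1 = (v x).+1.
    elim: x => [//|x IH] xL; have {}IH := IH (ltnW xL).
    case: (v_adj _ xL) => // e; have := @v_inj x x.+2; lia.
  have vE x : x < L -> v x = v 0 + x.
    by elim: x => [|x IH] xL; rewrite ?addn0 // vS // IH ?addnS //; lia.
  move=> x xL; have := vE L.-1; have := vL L.-1; have := vE x xL; lia.
right; have vS x : x.+1 < L -> v x = (v x.+1).+1.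
  elim: x => [//|x IH] xL; have {}IH := IH (ltnW xL).
  case: (v_adj _ xL) => // e; have := @v_inj x x.+2; lia.
have vE x : x < L -> v x + x = v 0.
  by elim: x => [|x IH] xL; [rewrite addn0|have := vS x xL; lia].
move=> x xL; have := vE L.-1; have := vL 0; have := vE x xL; lia.
Qed.

Lemma pullback_kernel_eq (T : finType) (U V : eqType) (s : {perm T})
    (c : T -> U) (d : T -> V) :
  pullback s (kernel c) = kernel d ->
  forall x y, (c (s x) == c (s y)) = (d x == d y).
Proof. by rewrite pullback_kernel => /kernelP. Qed.

Lemma pullback_surj (T : finType) (F : {set {set T * T}}) (s : {perm T}) :
  (forall K, K \in F -> pullback s K \in F) ->
  forall K, K \in F -> exists2 L, L \in F & pullback s L = K.
Proof.
move=> sF K KF; have : K \in pullback s @: F.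
  suff -> : pullback s @: F = F by [].
  apply/eqP; rewrite eqEcard card_imset ?leqnn ?andbT; last exact: pullback_inj.
  by apply/subsetP => _ /imsetP[L LF ->]; apply: sF.
by case/imsetP => L LF ->; exists L.
Qed.

Definition merge_label (x y : nat) : nat := if y <= x then y else y.-1.
(** The truncated predecessor sends both 0 and 1 to 0, so the block labelled 0 is {0, 1, k-1}. *)
Definition triple_label (k y : nat) : nat := if y == k.-1 then 0 else y.-1.

Definition merge_partition k (x : nat) := kernel (fun y : 'I_k => merge_label x y).
Definition triple_partition k := kernel (fun y : 'I_k => triple_label k y).

Lemma merge_is_partition m x : x < m -> is_partition m m (merge_partition m.+1 x).
Proof.
move=> xm; apply: is_partition_label => // [y yk|v vm]; rewrite /merge_label.
  by case: ifP; lia.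
by exists (if v <= x then v else v.+1); repeat case: ifP; lia.
Qed.

Lemma triple_is_partition m : 2 < m ->
  is_partition m (m - 1) (triple_partition m.+1).
Proof.
move=> m2; apply: is_partition_label; rewrite /triple_label.
- lia.
- by move=> y yk; case: ifP; lia.
by move=> v vm; exists v.+1; [lia|case: ifP; lia].
Qed.

(* The partitions merging x and x+1 make up a path on the first [n] points; the
   triple {0, 1, m} breaks its reversal and fixes the last point. *)
Definition path_family m n : {set {set 'I_m.+1 * 'I_m.+1}} :=
  triple_partition m.+1 |: [set merge_partition m.+1 x | x : 'I_n.-1].

Lemma merge_partition_inj m n : n.-1 <= m ->
  injective (fun x : 'I_n.-1 => merge_partition m.+1 x).
Proof.
move=> nm x y /kernelP e; apply: val_inj => /=.
have xk : x < m.+1 by have := ltn_ord x; lia.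
have xk' : x.+1 < m.+1 by have := ltn_ord x; lia.
have := e (Ordinal xk) (Ordinal xk'); rewrite /merge_label /=.
by repeat case: ifP; lia.
Qed.

Lemma nblocks_neq m (T : finType) a b (K L : {set T * T}) :
  a != b -> is_partition m a K -> is_partition m b L -> K <> L.
Proof. by move=> /eqP ab [_ Ka] [_ Lb] e; rewrite -Ka -Lb e in ab. Qed.

Lemma path_family_card m n : 2 < m -> 0 < n <= m -> #|path_family m n| = n.
Proof.
move=> m2 nm; rewrite cardsU1 card_imset ?card_ord; last first.
  by apply: merge_partition_inj; lia.
suff -> : triple_partition m.+1 \notin
  [set merge_partition m.+1 x | x : 'I_n.-1] by rewrite /=; lia.
apply/negP => /imsetP[x _]; have xm : x < m by have := ltn_ord x; lia.
by apply: nblocks_neq (triple_is_partition m2) (merge_is_partition xm); lia.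
Qed.

(** The triple is the only member with [m - 1] blocks, so [s] preserves it and permutes the merged
    pairs. Hence [s] acts on the path of the first [n] points as the identity or the reversal. *)
Lemma path_family_rigid m n : 2 < m -> 2 < n -> m - 1 <= n <= m ->
  rigid (path_family m n).
Proof.
move=> m2 n2 nm s sF.
have T_part : is_partition m (m - 1) (triple_partition m.+1) by apply: triple_is_partition.
have M_part (x : 'I_n.-1) : is_partition m m (merge_partition m.+1 x).
  by apply: merge_is_partition; have := ltn_ord x; lia.
have nm' : m - 1 != m by lia.
have sT : pullback s (triple_partition m.+1) = triple_partition m.+1.
  have := sF _ (setU11 _ _); rewrite in_setU1 => /predU1P[//|/imsetP[x _ e]].
  by have := nblocks_neq nm' (is_partition_pullback s T_part) (M_part x) e.
have sM (x : 'I_n.-1) : exists y : 'I_n.-1,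
    pullback s (merge_partition m.+1 y) = merge_partition m.+1 x.
  have xF : merge_partition m.+1 x \in path_family m n.
    by rewrite in_setU1 imset_f ?orbT.
  have [L] := pullback_surj sF xF; rewrite in_setU1 => /predU1P[->|/imsetP[y _ ->]].
    by move=> e; have := nblocks_neq nm' (is_partition_pullback s T_part) (M_part x) e.
  by exists y.
have sME (x : nat) (xn : x < n.-1) (x1 x2 : 'I_m.+1) : x1 = x :> nat -> x2 = x.+1 :> nat ->
   exists2 y, y < n.-1 & (s x1 = y :> nat /\ s x2 = y.+1 :> nat) \/
      (s x1 = y.+1 :> nat /\ s x2 = y :> nat).
  move=> e1 e2; have [y /pullback_kernel_eq/(_ x1 x2)] := sM (Ordinal xn).
  rewrite {3 4}/merge_label e1 e2 /= leqnn ltnn eqxx /merge_label => q.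
  have ne : s x1 <> s x2 by move=> /perm_inj e; move: e1 e2; rewrite e; lia.
  have ne' : s x1 <> s x2 :> nat by move=> /val_inj.
  exists y => //; move: q; move: ne'; move: (nat_of_ord (s x1)) (nat_of_ord (s x2)) => a b; repeat case: ifP; lia.
pose v x := nat_of_ord (s (inord x)).
have v_inj x y : x < m.+1 -> y < m.+1 -> v x = v y -> x = y.
  move=> xk yk /val_inj/perm_inj/(congr1 (@nat_of_ord _)).
  by rewrite !inordK.
have [||||vid|vrev] := @path_embedding v n.
- lia.
- move=> [|x] xn.
    have [|||y yn] := @sME 0 _ (inord 0) (inord 1); rewrite ?inordK //; try lia.
    rewrite /v; lia.
  have [|||y yn] := @sME x _ (inord x) (inord x.+1); rewrite ?inordK //; try lia.
  by rewrite /v; lia.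
- by move=> x y xn yn; apply: v_inj; lia.
- move=> x xn; have [|||y yn] := @sME x _ (inord x) (inord x.+1); rewrite ?inordK //; try lia.
  by rewrite /v; lia.
(* The point [m] shares the triple block with 0, and 0 and 1 are already fixed. *)
- have vT : v m = m.
    have := pullback_kernel_eq sT (inord m) (inord 0).
    rewrite {3 4}/triple_label !inordK //; try lia.
    have v0 := vid 0; have v1 := vid 1.
    have := @v_inj 0 m; have := @v_inj 1 m.
    rewrite -/(v m) -/(v 0) eqxx /triple_label. 
    have vk : v m < m.+1 by apply: ltn_ord.
    repeat case: ifP; lia.
  (* Besides the path and [m], at most one point is left: [m - 1], when [n = m - 1]. *)
  have vk x : x < m.+1 -> v x = x.
    move=> xk; have [/vid//|nx] := ltnP x n.
    have [->//|xk1] := eqVneq x m.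
    have [vxn|vxn] := ltnP (v x) n.
      have := vid _ vxn => e; have := @v_inj _ x _ xk e; lia.
    have vxk : v x < m.+1 by apply: ltn_ord.
    have := v_inj x m; lia.
  apply/permP => x; rewrite perm1; apply: val_inj.
  by rewrite -{1}(inord_val x); apply: vk.
(* The reversal sends 0 and 1, which lie in one block of the triple partition, to [n - 1] and
   [n - 2], which do not. *)
have := pullback_kernel_eq sT (inord 0) (inord 1).
rewrite {3 4}/triple_label !inordK //; try lia.
rewrite -/(v 1) -/(v 0) !vrev /triple_label; try lia.
repeat case: ifP; lia.
Qed.

(** * Interval families *)

(* Labels the blocks of the partition of 0, ..., k-1 into m-1 intervals whose
   m-2 cut positions form the cyclic interval starting at [i] among the k-1
   positions. *)
Definition cut_label (m k i x : nat) : nat :=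
  if i <= k - m + 1 then minn (x - i) (m - 2)
  else x - minn (x - (i - (k - m + 1))) (k - m + 1).

Definition cut_partition m k (i : nat) := kernel (fun x : 'I_k => cut_label m k i x).

Lemma cut_is_partition m k i : 2 < m < k -> i < k.-1 ->
  is_partition m (m - 1) (cut_partition m k i).
Proof.
move=> mk ik; apply: is_partition_label; rewrite /cut_label.
- lia.
- by move=> x xk; case: ifP; lia.
move=> v vm; have [iu|iu] := leqP i (k - m + 1); first by exists (i + v); lia.
by exists (if v <= i - (k - m + 1) then v else v + (k - m + 1)); case: ifP; lia.
Qed.

(** The right-hand side lists the [k - m + 1] uncut positions among the [k - 1]; the cuts wrap
    around exactly when [i > k - m + 1]. *)
Lemma cut_label_step m k i x : 2 < m < k ->
  (cut_label m k i x == cut_label m k i x.+1) =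
  if i <= k - m + 1 then (x < i) || (i + m - 2 <= x)
  else i - (k - m + 1) <= x < i.
Proof.
move=> mk; rewrite /cut_label; case: ifP => iu; apply/eqP/idP; lia.
Qed.

(** The start of a cyclic interval of cuts is the only cut position preceded by an uncut one. For
    [i < j], testing positions [j - 1] and [j] avoids the wraparound. *)
Lemma cut_partition_inj m k : 2 < m < k ->
  injective (fun i : 'I_k.-1 => cut_partition m k i).
Proof.
move=> mk i j e; apply: val_inj => /=.
wlog : i j e / i <= j.
  by move=> W; case: (leqP i j) => [|/ltnW] /W; [apply|move=> ->].
move=> ij; apply/eqP; apply: contraT => nij.
have lk := ltn_ord j; have /kernelP ee := e.
have st x : x.+1 < k -> (cut_label m k i x == cut_label m k i x.+1) =
    (cut_label m k j x == cut_label m k j x.+1).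
  by move=> xk; have := ee (Ordinal (ltnW xk)) (Ordinal xk).
have k1 : j.-1.+1 < k by lia.
have k2 : j.+1 < k by lia.
have := st _ k1; have := st _ k2; rewrite !cut_label_step //.
by have [iu|iu] := leqP i (k - m + 1); have [ju|ju] := leqP j (k - m + 1); lia.
Qed.

Lemma cut_label_mono m k i x y : x <= y -> cut_label m k i x <= cut_label m k i y.
Proof. by rewrite /cut_label; case: ifP; lia. Qed.

Lemma cut_separates m k x z : 2 < m < k -> x.+1 < k -> z < k -> z != x ->
  z != x.+1 ->
  exists2 i, i < k.-1 & cut_label m k i x = cut_label m k i x.+1 /\
                        cut_label m k i x <> cut_label m k i z.
Proof.
(* Position [x] must stay uncut. For [z] on the right, the cuts start at [x + 1]; for [z] on the
   left, they end at [x - 1], and their start is [x - (m - 2)] modulo [k - 1]. *)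
move=> mk xk zk zx zx1; have [xz|zx'] := ltnP x z.
  by exists x.+1; rewrite /cut_label; repeat case: ifP; lia.
have [xm|xm] := leqP (m - 2) x.
  by exists (x - (m - 2)); rewrite /cut_label; repeat case: ifP; lia.
by exists (x + (k - m + 1)); rewrite /cut_label; repeat case: ifP; lia.
Qed.

(** Truncated subtraction puts the first [k - m + 1] points in one block and leaves the others as
    singletons. *)
Definition corner_partition m k := kernel (fun x : 'I_k => nat_of_ord x - (k - m)).

Lemma corner_is_partition m k : 2 < m < k -> is_partition m m (corner_partition m k).
Proof.
move=> mk; apply: (is_partition_label (f := subn^~ (k - m))) => // [x xk|v vm].
  lia.
by exists (v + (k - m)); lia.
Qed.

Definition rev_perm k : {perm 'I_k} := perm (@rev_ord_inj k).

Lemma corner_not_rev m k : 2 < m < k ->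
  pullback (rev_perm k) (corner_partition m k) <> corner_partition m k.
Proof.
move=> mk /pullback_kernel_eq e.
have k0 : 0 < k by lia.
have k1 : 1 < k by lia.
by have := e (Ordinal k0) (Ordinal k1); rewrite !permE /=; lia.
Qed.

Definition cut_family m k (T : {set {set 'I_k * 'I_k}}) : {set {set 'I_k * 'I_k}} :=
  [set cut_partition m k i | i : 'I_k.-1] :|: (corner_partition m k |: T).

(* Two points are neighbours exactly when no third point is merged with them
   by every interval partition that merges them. *)
Lemma cut_preserving m k (s : {perm 'I_k}) : 2 < m < k ->
  (forall i : 'I_k.-1, exists j : 'I_k.-1,
    pullback s (cut_partition m k j) = cut_partition m k i) ->
  s = 1%g \/ s = rev_perm k.
Proof.
move=> mk sR; have k0 : 0 < k by lia.
pose o := Ordinal k0; pose v x := nat_of_ord (s (insubd o x)).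
have vE (x : 'I_k) : s x = v x :> nat by rewrite /v valKd.
have s_inj (x y : 'I_k) : v x = v y -> x = y.
  by rewrite -!vE => /val_inj/perm_inj.
have [||||vid|vrev] := @path_embedding v k.
- lia.
- by move=> x _; apply: ltn_ord.
- move=> x y xk yk e; have := s_inj (Ordinal xk) (Ordinal yk) e.
  by move=> /(congr1 val).
- move=> x xk; pose x0 := Ordinal (ltnW xk); pose x1 := Ordinal xk.
  have v01 : v x <> v x.+1 by move=> /(s_inj x0 x1)/(congr1 val) /=; lia.
  (* Blocks are intervals, so one containing both images also contains [z]. Yet some partition
     merges [x] and [x.+1] but not the preimage [t] of [z], and it is the pullback of an interval
     partition. *)
  have key z : v x < z < v x.+1 \/ v x.+1 < z < v x -> False.
    move=> zv; have zk : z < k.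
      by have := ltn_ord (s x0); have := ltn_ord (s x1); rewrite !vE /=; lia.
    pose t := (s^-1 (Ordinal zk))%g.
    have vt : v t = z by rewrite -vE permKV.
    have tx : t != x :> nat by apply/eqP => e; rewrite e in vt; lia.
    have tx1 : t != x.+1 :> nat by apply/eqP => e; rewrite e in vt; lia.
    have [i ik [e1 e2]] := cut_separates mk xk (ltn_ord t) tx tx1.
    have [j /pullback_kernel_eq sj] := sR (Ordinal ik).
    have e : cut_label m k j (v x) = cut_label m k j (v x.+1).
      by apply/eqP; have := sj x0 x1; rewrite !vE /= e1 eqxx.
    have ne : cut_label m k j (v x) <> cut_label m k j z.
      by apply/eqP; have := sj x0 t; rewrite !vE vt /= => ->; apply/eqP.
    have := @cut_label_mono m k j; case: zv => /andP[z1 z2] mono.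
      by have := mono _ _ (ltnW z1); have := mono _ _ (ltnW z2); lia.
    by have := mono _ _ (ltnW z1); have := mono _ _ (ltnW z2); lia.
  have := key (v x).+1; have := key (v x.+1).+1; lia.
- by left; apply/permP => x; rewrite perm1; apply: val_inj; rewrite /= vE vid.
right; apply/permP => x; rewrite permE; apply: val_inj; rewrite /= vE vrev //.
lia.
Qed.

(** Numbers of blocks keep the interval partitions among themselves, leaving only the identity and
    the reversal; the latter would send the corner partition outside the family. *)
Lemma cut_family_rigid m k (T : {set {set 'I_k * 'I_k}}) : 2 < m < k ->
  (forall K, K \in T -> is_partition m m K) ->
  pullback (rev_perm k) (corner_partition m k) \notin T ->
  rigid (cut_family m T).
Proof.
move=> mk Tm revT s sF; have mm : m - 1 != m by lia.
have R_part (i : 'I_k.-1) : is_partition m (m - 1) (cut_partition m k i).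
  exact: cut_is_partition.
have E_part := corner_is_partition mk.
have ET_part K : K \in corner_partition m k |: T -> is_partition m m K.
  by rewrite in_setU1 => /predU1P[->|/Tm].
have [|->|s_rev] := @cut_preserving m k s mk _ => //.
  move=> i; have iF : cut_partition m k i \in cut_family m T.
    by rewrite in_setU imset_f.
  have [L] := pullback_surj sF iF; rewrite in_setU => /orP[/imsetP[j _ ->]|/ET_part LP e].
    by exists j.
  have := is_partition_pullback s LP; rewrite e => LP'.
  by case: (nblocks_neq mm (R_part i) LP').
have : pullback s (corner_partition m k) \in cut_family m T.
  by apply: sF; rewrite in_setU setU11 orbT.
rewrite in_setU in_setU1 s_rev (negPf revT) orbF => /orP[/imsetP[i _ e]|/eqP].
  have := is_partition_pullback (rev_perm k) E_part; rewrite e => EP.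
  by case: (nblocks_neq mm (R_part i) EP).
by move=> /(corner_not_rev mk).
Qed.

(** * Filler partitions and the size of determining sets *)

Lemma subset_of_card (T : finType) (A : {set T}) t : t <= #|A| ->
  exists2 B : {set T}, B \subset A & #|B| = t.
Proof.
move=> tA; exists [set:: take t (enum A)].
  by apply/subsetP => x; rewrite inE => /mem_take; rewrite mem_enum.
rewrite cardsE; have /card_uniqP -> : uniq (take t (enum A)).
  by rewrite take_uniq // enum_uniq.
by rewrite size_takel // -cardE.
Qed.

Lemma cost_cut_family m n k (A : {set {set 'I_k * 'I_k}}) :
  2 < m < k -> k <= n -> (forall K, K \in A -> is_partition m m K) ->
  n - k <= #|A| - 2 -> cost (hamming m n) <= k.
Proof.
move=> mk kn Am An.
pose E := corner_partition m k; pose E' := pullback (rev_perm k) E.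
(* The family already has [k - 1] interval partitions and [E], so [n - k] fillers are missing.
   Avoiding [E] and its reversal [E'] costs at most two members of [A]. *)
have [T TA Tn] : exists2 T : {set {set 'I_k * 'I_k}}, T \subset A :\ E :\ E' & #|T| = n - k.
  have D1 L (B : {set {set 'I_k * 'I_k}}) : #|B| <= #|B :\ L|.+1.
    by rewrite (cardsD1 L B); case: (L \in B).
  apply: subset_of_card; apply: leq_trans An _; rewrite leq_subLR.
  by apply: leq_trans (D1 E A) _; rewrite ltnS; apply: D1.
have T_part K : K \in T -> is_partition m m K.
  by move=> /(subsetP TA); rewrite !inE => /and3P[_ _ /Am].
have ET : E \notin T by apply/negP => /(subsetP TA); rewrite !inE eqxx andbF.
have E'T : E' \notin T by apply/negP => /(subsetP TA); rewrite !inE eqxx.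
have mm : m - 1 != m by lia.
have ET_part K : K \in E |: T -> is_partition m m K.
  by rewrite in_setU1 => /predU1P[->|/T_part //]; apply: corner_is_partition.
apply: (@cost_rigid m n k (cut_family m T)).
- lia.
- rewrite cardsU [X in _ - #|pred_of_set X|](_ : _ = set0) ?cards0; last first.
    apply/setP => K; rewrite in_setI in_set0; apply/negP => /andP[/imsetP[i _ ->] /ET_part].
    by move=> /(nblocks_neq mm (cut_is_partition mk (ltn_ord i))).
  rewrite cardsU1 ET Tn card_imset ?card_ord; last exact: cut_partition_inj.
  lia.
- move=> K; rewrite in_setU => /orP[/imsetP[i _ ->]|/ET_part KP].
    by exists (m - 1) => //; apply: cut_is_partition.
  by exists m => //; lia.
exact: cut_family_rigid.
Qed.

(* A column of a determining set misses at most one symbol; giving it to a new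
   row (any symbol will do if none is missing) makes all symbols occur. *)
Lemma determining_pool m n k (S : {set word m n}) : 1 < m ->
  @determining (hamming m n) S -> #|S| = k ->
  exists2 A : {set {set 'I_k.+1 * 'I_k.+1}}, #|A| = n &
    forall K, K \in A -> is_partition m m K.
Proof.
move=> m1 detS <-; pose o := Ordinal (ltnW m1).
pose im i := [set x i | x : word m n in S].
pose f i (t : 'I_#|S|.+1) : 'I_m :=
  if unlift ord_max t is Some u then (enum_val u : word m n) i
  else odflt o [pick v | v \notin im i].
exists [set kernel (f i) | i : 'I_n].
  rewrite card_imset ?card_ord // => i j /kernelP fij.
  apply: (determining_columns m1 detS) => x y xS yS.
  have := fij (lift ord_max (enum_rank_in xS x)) (lift ord_max (enum_rank_in xS y)).
  by rewrite /f !liftK !enum_rankK_in.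
move=> _ /imsetP[i _ ->]; split; first by exists (f i).
rewrite nblocks_kernel -[RHS]card_ord -cardsT; congr #|pred_of_set _|.
apply/setP => v; rewrite inE; apply/imsetP.
have [/imsetP[x xS ->]|vS] := boolP (v \in im i).
  by exists (lift ord_max (enum_rank_in xS x)) => //; rewrite /f liftK enum_rankK_in.
exists ord_max => //; rewrite /f unlift_none; case: pickP => [w wS|/(_ v)]; last by rewrite vS.
apply/eqP; apply: contraT => vw.
have : 1 < #|~: im i| by apply/card_gt1P; exists v, w; rewrite !inE.
have := cardsC (im i); have := determining_symbols i detS; rewrite card_ord -/(im i).
by move=> a b c; lia.
Qed.

(** With fewer than [m] vertices, the [m - 1] symbols required in each column make every column
    injective on [S]; two columns would then induce the same partition. *)
Lemma det_hamming_ge m n : 2 < m -> 1 < n -> m <= det (hamming m n).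
Proof.
move=> m2 n1; have [S detS <-] := det_witness (hamming m n).
have m1 : 1 < m by lia.
pose i0 : 'I_n := Ordinal (ltnW n1); pose i1 : 'I_n := Ordinal n1.
have symb := @determining_symbols m n S _ detS.
rewrite leqNgt; apply/negP => lt.
have inj i : {in S &, injective (fun x : word m n => x i)}.
  apply/imset_injP; rewrite eqn_leq leq_imset_card /=.
  by apply: leq_trans (symb i); rewrite leq_subRL ?add1n // ltnW.
suff /(congr1 val) : i0 = i1 by [].
apply: (@determining_columns m n S) => // x y xS yS.
by rewrite (inj_in_eq (inj i0)) // (inj_in_eq (inj i1)).
Qed.

(** * The 3 x 3 grid and the theorem *)

Definition transpose (a b x : nat) : nat :=
  if x == a then b else if x == b then a else x.

Definition grid_invariant (F : nat -> nat -> bool) (h : nat -> nat -> nat * nat) :=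
  all (fun x => all (fun y => F (h x y).1 (h x y).2 == F x y) (iota 0 3)) (iota 0 3).

(** When [t] holds, one coordinate is moved by a product of two transpositions and the other by its
    inverse, so that the exchange is an involution. *)
Definition grid_act (t : bool) (a b c d x y : nat) : nat * nat :=
  if t then (transpose a b (transpose c d y), transpose c d (transpose a b x))
  else (transpose a b x, transpose c d y).

(* Every 2-coloring of the 3 x 3 grid is invariant under a product of two row or
   column transpositions, or under an involution exchanging rows and columns. *)
Definition grid_symmetric (F : nat -> nat -> bool) : bool :=
  has (fun t => has (fun a => has (fun b => has (fun c => has (fun d =>
    [|| t, a != b | c != d] && grid_invariant F (grid_act t a b c d))
  (iota 0 3)) (iota 0 3)) (iota 0 3)) (iota 0 3)) [:: false; true].

(** Only the nine values of [F] on the grid matter; replacing [F] by their table reduces the claim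
    to a computation over 512 colorings. *)
Lemma grid_symmetricT (F : nat -> nat -> bool) :
  exists t a b c d, [/\ [&& a < 3, b < 3, c < 3 & d < 3],
    [|| t, a != b | c != d] &
    forall x y, x < 3 -> y < 3 ->
      F (grid_act t a b c d x y).1 (grid_act t a b c d x y).2 = F x y].
Proof.
pose N b0 b1 b2 b3 b4 b5 b6 b7 b8 x y :=
  nth false (nth [::] [:: [:: b0; b1; b2]; [:: b3; b4; b5]; [:: b6; b7; b8]] x) y.
have sym b0 b1 b2 b3 b4 b5 b6 b7 b8 : grid_symmetric (N b0 b1 b2 b3 b4 b5 b6 b7 b8).
  by move: b0 b1 b2 b3 b4 b5 b6 b7 b8; do 9!case; vm_compute.
pose G := N (F 0 0) (F 0 1) (F 0 2) (F 1 0) (F 1 1) (F 1 2) (F 2 0) (F 2 1) (F 2 2).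
have FG x y : x < 3 -> y < 3 -> F x y = G x y by case: x y => [|[|[|x]]] [|[|[|y]]].
have /hasP[t _ /hasP[a ia /hasP[b ib /hasP[c ic /hasP[d id /andP[nt inv]]]]]] :
  grid_symmetric G by apply: sym.
rewrite !mem_iota /= in ia ib ic id.
exists t, a, b, c, d; split=> // [|x y x3 y3]; first by rewrite ia ib ic id.
have /allP/(_ x) := inv; rewrite mem_iota => /(_ x3)/allP/(_ y).
rewrite mem_iota => /(_ y3)/eqP inv'.
have /andP[a1 a2] :
    ((grid_act t a b c d x y).1 < 3) && ((grid_act t a b c d x y).2 < 3).
  by rewrite /grid_act /transpose; case: (t) => /=; repeat case: ifP => _; lia.
by rewrite !FG.
Qed.

Lemma tperm_transpose m (a b x : 'I_m) : tperm a b x = transpose a b x :> nat.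
Proof.
rewrite /transpose; case: tpermP => [->|->|/eqP xa /eqP xb]; rewrite ?eqxx //.
  by case: eqP => [->|].
by rewrite !val_eqE (negPf xa) (negPf xb).
Qed.

Lemma hamming32_not_distinguishable : ~~ distinguishable (hamming 3 2) 2.
Proof.
apply/existsP => -[c /forall_inP dc].
pose pt x y : word 3 2 := [ffun i => if i == ord0 then inord x else inord y].
pose F x y := c (pt x y) == ord0.
have cF (z : word 3 2) : (c z == ord0) = F (z ord0) (z ord_max).
  rewrite /F; congr (c _ == _); apply/ffunP => i; rewrite ffunE.
  case: (unliftP ord0 i) => [j ->|->] /=; last by rewrite inord_val.
  by rewrite inord_val; congr (z _); apply: val_inj; rewrite /= ord1.
have [t [x1 [x2 [x3 [x4 [/and4P[h1 h2 h3 h4] nt inv]]]]]] := grid_symmetricT F.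
pose g := tperm (Ordinal h1) (Ordinal h2); pose h := tperm (Ordinal h3) (Ordinal h4).
pose r : {perm 'I_2} := if t then tperm ord0 ord_max else 1%g.
pose u (i : 'I_2) : {perm 'I_3} :=
  if t then if i == ord0 then (h * g)%g else (g * h)%g
  else if i == ord0 then g else h.
have [p pa pE] := wreath_aut r u.
have pc (z : word 3 2) : c (p z) = c z.
  suff : (c (p z) == ord0) = (c z == ord0).
    by case: (c (p z)) (c z) => [[|[|?]] ?] [[|[|?]] ?] //= _; apply: val_inj.
  rewrite !cF -[RHS]inv // !pE /u /r /grid_act; case: (t) => /=.
    by rewrite tpermL tpermR !permM !tperm_transpose.
  by rewrite !perm1 !tperm_transpose.
have /implyP/(_ (introT (@preserves_classesP (hamming 3 2) 2 c p) pc))/eqP p1 := dc p pa.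
have {}pE (z : word 3 2) i : z i = u i (z (r i)).
  by rewrite -pE p1 perm1.
(* If the coordinates are exchanged, the identity would make one coordinate of a word a function of
   the other. Otherwise one of the two transpositions is nontrivial. *)
move: nt pE; rewrite /u /r; case: (t) => /= [_|nt] pE.
  have := pE [ffun i => if i == ord0 then (h * g)%g ord0 else ord0] ord0.
  have := pE [ffun i => if i == ord0 then (h * g)%g ord_max else ord0] ord0.
  by rewrite !ffunE /= tpermL /= => /perm_inj.
case/orP: nt => /eqP; apply.
  have := pE [ffun=> Ordinal h1] ord0; rewrite !ffunE /= tpermL.
  by move=> /(congr1 val).
have := pE [ffun=> Ordinal h3] ord_max; rewrite !ffunE /= tpermL.
by move=> /(congr1 val).
Qed.

Theorem theorem4p5 (m n : nat) (hmn : 2 <= m - 1 <= n)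
    (hdist : dist (hamming m n) = 2) :
  cost (hamming m n) = det (hamming m n) \/
  cost (hamming m n) = det (hamming m n) + 1.
Proof.
have dist2 : distinguishable (hamming m n) 2.
  by rewrite -hdist /dist; case: ex_minnP.
have det_le : det (hamming m n) <= cost (hamming m n).
  have [c [i [dc <-]]] := cost_witness dist2.
  apply: det_leq; apply/forall_inP => p pa; apply/implyP => /forall_inP fixS.
  have /forall_inP/(_ p pa)/implyP := dc; apply; apply/preserves_classesP => x.
  have pS y : y \in color_class c i -> p y = y by move=> /fixS/eqP.
  have [xS|xS] := boolP (x \in color_class c i); first by rewrite pS.
  (* By injectivity, no vertex outside a pointwise fixed class enters it; with two colors, the
     outside is a single class. *)
  have pxS : p x \notin color_class c i.
    by apply: contra xS => pxS; rewrite -{1}(perm_inj (pS _ pxS)).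
  apply: val_inj; move: xS pxS; rewrite !inE -!val_eqE.
  by have := (ltn_ord i, ltn_ord (c x), ltn_ord (c (p x))) => -[[]] /=; lia.
suff : cost (hamming m n) <= (det (hamming m n)).+1 by lia.
have m2 : 2 < m by lia.
have [S detS S_det] := det_witness (hamming m n).
have det_ge : m <= det (hamming m n) by apply: det_hamming_ge; lia.
have [nm|mn] := leqP n m.
  have n2 : 2 < n.
    rewrite ltnNge; apply/negP => n2.
    have [m3 n2'] : m = 3 /\ n = 2 by lia.
    by move: dist2; rewrite m3 n2' (negPf hamming32_not_distinguishable).
  apply: leq_trans (_ : m.+1 <= _); last by [].
  apply: (@cost_rigid m n m.+1 (path_family m n)).
  - lia.
  - by apply: path_family_card; lia.
  - move=> K; rewrite in_setU1 => /predU1P[->|/imsetP[x _ ->]].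
      by exists (m - 1) => //; apply: triple_is_partition.
    exists m; first lia; apply: merge_is_partition; have := ltn_ord x; lia.
  by apply: path_family_rigid => //; lia.
(* If [n] is at most [det], then [k = n] rows suffice without fillers. Otherwise [k = det + 1 <= n],
   and a minimum determining set with one added row gives a pool of [n] partitions, enough since
   [k >= 2]. *)
have [nD|Dn] := leqP n (det (hamming m n)).
  apply: leq_trans (_ : n <= _); last lia.
  apply: (@cost_cut_family m n n set0) => [||K|]; rewrite ?inE //; lia.
have [|A An A_part] := @determining_pool m n _ S _ detS S_det; first lia.
apply: (@cost_cut_family m n _ A) => //; lia.
Qed.
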